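(* Let $\mathcal{H}$ be a hypergraph and $e\in E(\mathcal{H})$ an edge. Then $|\mathcal{E}(\mathcal{H})-\mathcal{E}(\mathcal{H}-e)|\le 2|e|-2$, where $\mathcal{H}-e=(V,E\setminus\{e\})$.
   Context: A hypergraph $\mathcal{H}=(V,E)$ consists of a finite vertex set $V$ and a set $E$ of edges, each a subset of $V$ of cardinality at least $2$ (distinct edges distinct). For $i\neq j$, $d(\{i,j\})$ is the number of edges containing both $i$ and $j$; the adjacency matrix $\mathbf{A}(\mathcal{H})$ has zero diagonal and $(i,j)$ entry $d(\{i,j\})$. The energy $\mathcal{E}(\mathcal{H})$ is the sum of the absolute values of the eigenvalues of $\mathbf{A}(\mathcal{H})$. *)

(* Defs.v *)
From mathcomp Require Import all_boot all_order all_algebra.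

Set Implicit Arguments.
Unset Strict Implicit.
Unset Printing Implicit Defensive.

Import Order.TTheory GRing.Theory Num.Theory.
Local Open Scope ring_scope.

Record hypergraph (V : finType) := Hypergraph {
  edges : {set {set V}};
  card_edge : forall e, e \in edges -> (2 <= #|e|)%N
}.

Lemma card_edge_delete (V : finType) (H : hypergraph V) (e : {set V}) :
  forall f, f \in edges H :\ e -> (2 <= #|f|)%N.
Proof. by move=> f /setD1P[_ /card_edge]. Qed.

Definition edge_delete (V : finType) (H : hypergraph V) (e : {set V}) :
    hypergraph V :=
  Hypergraph (@card_edge_delete V H e).

Definition codegree (V : finType) (H : hypergraph V) (i j : V) : nat :=
  #|[set e in edges H | (i \in e) && (j \in e)]|.

(* Rows and columns are indexed by the vertices, listed in the order of the    *)
(* canonical enumeration [enum_val : 'I_#|V| -> V].                            *)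
Definition adjacency (C : nzRingType) (V : finType) (H : hypergraph V) :
    'M[C]_#|V| :=
  \matrix_(i, j) if i == j then 0
                 else (codegree H (enum_val i) (enum_val j))%:R.

(* The eigenvalues with algebraic multiplicity, that is, the sequence [s] with *)
(* [char_poly A = \prod_(z <- s) ('X - z%:P)].                                 *)
Definition eigenvalues (C : numClosedFieldType) (n : nat) (A : 'M[C]_n) :
    seq C :=
  sval (closed_field_poly_normal (char_poly A)).

(* The adjacency matrix is taken over a closed field [C], such as the complex  *)
(* numbers, so that the characteristic polynomial splits by construction.      *)
Definition energy (C : numClosedFieldType) (V : finType) (H : hypergraph V) :
    C :=
  \sum_(z <- eigenvalues (adjacency C H)) `|z|.

(* Main.v *)
(* The energy of [H] is the trace norm of its adjacency matrix [A].  Choosing phases *)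
(* in an orthonormal eigenbasis gives a unitary [U] with [\tr (A *m U)] equal to the *)
(* trace norm of [A], while [`|\tr (A' *m U)|] is at most the trace norm of [A'] for *)
(* every normal [A'].  Hence the two energies differ by at most [`|\tr (B *m U)|],   *)
(* where [B] is the adjacency matrix of the clique on [e] and [U] is unitary, and    *)
(* this is at most the trace norm [2 * #|e| - 2] of [B].                             *)
Require Import Defs.
From mathcomp Require Import all_boot all_order all_algebra.
From mathcomp Require Import ring.

Import Order.TTheory GRing.Theory Num.Theory.
Local Open Scope ring_scope.
Local Open Scope sesquilinear_scope.

Lemma char_poly_conj (R : comUnitRingType) (n : nat) (P A : 'M[R]_n) :
  P \in unitmx -> char_poly (invmx P *m A *m P) = char_poly A.
Proof.
move=> Pu; rewrite /char_poly /char_poly_mx.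
have PP : map_mx polyC (invmx P) *m map_mx polyC P = 1%:M.
  by rewrite -map_mxM mulVmx // map_mx1.
have -> : 'X%:M - map_mx polyC (invmx P *m A *m P) =
    map_mx polyC (invmx P) *m ('X%:M - map_mx polyC A) *m map_mx polyC P.
  rewrite mulmxBr mulmxBl !map_mxM; congr (_ - _).
  by rewrite scalar_mxC -mulmxA PP mulmx1.
by rewrite !det_mulmx mulrAC -det_mulmx PP det1 mul1r.
Qed.

(** By the spectral theorem [A] is similar to its spectral diagonal, so both families are the roots
    of [char_poly A]. The order of the root list is unspecified, whence a permutation argument. *)
Lemma sum_eigenvalues_normal (C : numClosedFieldType) (n : nat) (A : 'M[C]_n)
    (f : C -> C) :
  A \is normalmx ->
  \sum_(z <- eigenvalues A) f z = \sum_i f (spectral_diag A 0 i).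
Proof.
move=> /orthomx_spectralP eqA; rewrite /eigenvalues.
case: closed_field_poly_normal => s /= eqs.
suff /(perm_big _)-> : perm_eq s [seq spectral_diag A 0 i | i : 'I_n].
  by rewrite big_map big_enum.
apply/prod_XsubC_eq; rewrite big_map big_enum /=.
move: eqs; rewrite (monicP (char_poly_monic A)) scale1r => <-.
rewrite {1}eqA char_poly_conj ?spectral_unit // char_poly_trig ?diag_mx_is_trig //.
by apply: eq_bigr => i _; rewrite mxE eqxx mulr1n.
Qed.

(* Cauchy-Schwarz is not needed: AM-GM entry by entry suffices, as [v *m U] and [v]  *)
(* have the same norm.                                                               *)
Lemma unitary_form_le (C : numClosedFieldType) (n : nat) (U : 'M[C]_n)
    (v : 'rV[C]_n) :
  U \is unitarymx -> `|(v *m U *m v ^t*) 0 0| <= \sum_i `|v 0 i| ^+ 2.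
Proof.
move=> Uu; set w := v *m U.
have eqw : \sum_i `|w 0 i| ^+ 2 = \sum_i `|v 0 i| ^+ 2.
  have normE (u : 'rV[C]_n) : \sum_i `|u 0 i| ^+ 2 = (u *m u ^t*) 0 0.
    by rewrite mxE; apply: eq_bigr => i _; rewrite !mxE normCK.
  by rewrite !normE trmx_mul map_mxM mulmxA mulmxtVK.
have amgm (x y : C) : `|x| * `|y| <= (`|x| ^+ 2 + `|y| ^+ 2) / 2.
  rewrite ler_pdivlMr ?ltr0n // -subr_ge0.
  have -> : `|x| ^+ 2 + `|y| ^+ 2 - `|x| * `|y| * 2 = (`|x| - `|y|) ^+ 2 by ring.
  by rewrite real_exprn_even_ge0 // rpredB // normr_real.
rewrite mxE; apply: le_trans (ler_norm_sum _ _ _) _.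
apply: (@le_trans _ _ (\sum_i (`|w 0 i| ^+ 2 + `|v 0 i| ^+ 2) / 2)).
  by apply: ler_sum => i _; rewrite !mxE normrM norm_conjC amgm.
by rewrite -mulr_suml big_split /= eqw mulrDl -splitr.
Qed.

Lemma delta_form (C : numClosedFieldType) (n : nat) (U : 'M[C]_n) (i j : 'I_n) :
  (delta_mx 0 i : 'rV_n) *m U *m (delta_mx 0 j : 'rV_n) ^t* = (U i j)%:M.
Proof.
by rewrite trmx_delta map_delta_mx -rowE -colE [LHS]mx11_scalar !mxE.
Qed.

Lemma unitary_diag_le1 (C : numClosedFieldType) (n : nat) (U : 'M[C]_n)
    (i : 'I_n) :
  U \is unitarymx -> `|U i i| <= 1.
Proof.
move=> Uu; have := unitary_form_le _ _ _ (delta_mx 0 i) Uu.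
rewrite delta_form mxE mulr1n (bigD1 i) //= big1 => [|j /negPf ji].
  by rewrite mxE !eqxx normr1 expr1n addr0.
by rewrite mxE ji andbF normr0 expr0n.
Qed.

(** In an orthonormal eigenbasis of [A] the trace becomes the sum of the [d 0 i * W i i], where [W]
    is [U] in that basis. It is still unitary, so its diagonal entries have modulus at most 1. *)
Lemma norm_mxtrace_normal_le (C : numClosedFieldType) (n : nat) (A U : 'M[C]_n) :
  A \is normalmx -> U \is unitarymx ->
  `|\tr (A *m U)| <= \sum_(z <- eigenvalues A) `|z|.
Proof.
move=> An Uu; rewrite sum_eigenvalues_normal //.
move: An => /orthomx_spectralP {1}->.
set P := spectralmx A; set d := spectral_diag A.
have Pu : P \is unitarymx by exact: spectral_unitarymx.
rewrite -!mulmxA mxtrace_mulC -!mulmxA invmx_unitary // [in P *m _]mulmxA.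
have : P *m U *m P ^t* \is unitarymx by rewrite !mul_unitarymx // trmxC_unitary.
set W := _ *m P ^t* => Wu.
apply: le_trans (ler_norm_sum _ _ _) _; apply: ler_sum => i _.
by rewrite mul_diag_mx mxE normrM ler_piMr // unitary_diag_le1.
Qed.

Lemma normal_phase (C : numClosedFieldType) (n : nat) (A : 'M[C]_n) :
  A \is normalmx ->
  exists2 U : 'M[C]_n, U \is unitarymx &
    \tr (A *m U) = \sum_(z <- eigenvalues A) `|z|.
Proof.
move=> An; set P := spectralmx A; set d := spectral_diag A.
have Pu : P \is unitarymx by exact: spectral_unitarymx.
(* Conjugate phases turn each eigenvalue into its modulus. A zero eigenvalue gets phase 1, which
   keeps [U] unitary and adds nothing to the trace. *)
pose s : 'rV[C]_n :=
  \row_i (if d 0 i == 0 then 1 else (d 0 i)^* / `|d 0 i|).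
exists (P ^t* *m diag_mx s *m P).
  rewrite !mul_unitarymx // ?trmxC_unitary //.
  apply/unitarymxP; rewrite tr_diag_mx map_diag_mx mulmx_diag.
  apply/matrixP => i j; rewrite !mxE; congr (_ *+ _).
  rewrite -normCK; case: ifPn => [_|dn0]; first by rewrite normr1 expr1n.
  by rewrite normrM normfV normr_id norm_conjC divff ?normr_eq0 // expr1n.
rewrite sum_eigenvalues_normal //.
move: An => /orthomx_spectralP {1}->; rewrite -/P -/d invmx_unitary //.
rewrite !mulmxA mulmxtVK // mxtrace_mulC !mulmxA.
rewrite (unitarymxP Pu) mul1mx mulmx_diag mxtrace_diag.
apply: eq_bigr => i _; rewrite !mxE; case: eqP => [->|/eqP dn0].
  by rewrite mul0r normr0.
by rewrite mulrA -normCK expr2 mulfK ?normr_eq0.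
Qed.

(* With [v] the indicator of [K] and [k = #|K|], the matrix [J - 1] of the clique on *)
(* [K] is [(k - 1) / k] times [v v^T] minus [1 / (2 k)] times the sum over [i, j] in *)
(* [K] of [(e_i - e_j) (e_i - e_j)^T].                                               *)
Lemma unitary_offdiag_le (C : numClosedFieldType) (n : nat) (U : 'M[C]_n)
    (K : {set 'I_n}) :
  U \is unitarymx -> (0 < #|K|)%N ->
  `|\sum_(i in K) \sum_(j in K | i != j) U i j| <= 2 * #|K|%:R - 2.
Proof.
move=> Uu K_gt0; set k : C := #|K|%:R.
have k_gt0 : 0 < k by rewrite ltr0n.
have k_ge1 : 1 <= k by rewrite ler1n.
have k_neq0 : k != 0 by rewrite gt_eqF.
pose S := \sum_(i in K) \sum_(j in K) U i j.
pose T := \sum_(i in K) U i i.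
(* [S] is the form of [U] at the indicator vector of [K], whose squared norm is [k]. *)
have S_le : `|S| <= k.
  have := unitary_form_le _ _ _ (\sum_(i in K) delta_mx 0 i) Uu.
  rewrite mulmx_suml mulmx_suml summxE.
  rewrite (eq_bigr (fun i => \sum_(j in K) U i j)) -/S => [|i _].
    move=> /le_trans; apply; rewrite (bigID (mem K)) /=.
    rewrite [X in _ + X]big1 => [|i iK]; last first.
      rewrite summxE big1 ?normr0 ?expr0n // => j jK.
      by rewrite mxE; case: (i =P j) => [eij|_]; move: iK; rewrite ?andbF // eij jK.
    rewrite addr0 (eq_bigr (fun=> 1)) ?sumr_const // => i iK.
    rewrite summxE (bigD1 i) //= big1 => [|j /andP[_ /negPf ji]].
      by rewrite mxE !eqxx addr0 normr1 expr1n.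
    by rewrite mxE eq_sym ji andbF.
  rewrite raddf_sum raddf_sum mulmx_sumr summxE.
  by apply: eq_bigr => j _; rewrite delta_form mxE mulr1n.
(* This is the form of [U] at [e_i - e_j], a vector of squared norm 2. *)
have D_le (i j : 'I_n) : i != j -> `|U i i + U j j - U i j - U j i| <= 2.
  move=> ij; have := unitary_form_le _ _ _ (delta_mx 0 i - delta_mx 0 j) Uu.
  rewrite linearB /= map_mxB !mulmxBl !mulmxBr !delta_form !mxE !mulr1n.
  rewrite (bigD1 i) //= (bigD1 j) ?(eq_sym j) //= big1 => [|l /andP[li lj]].
    rewrite !mxE !eqxx (negPf ij) eq_sym (negPf ij) /= subr0 sub0r normrN normr1.
    rewrite expr1n addr0; congr (`|_| <= _); ring.
  by rewrite !mxE (negPf li) (negPf lj) /= subrr normr0 expr0n.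
pose D := \sum_(i in K) \sum_(j in K) (U i i + U j j - U i j - U j i).
have natk (x : C) : x *+ #|K| = k * x by rewrite mulr_natl.
have eqD : D = 2 * k * T - 2 * S.
  rewrite /D; under eq_bigr => i _ do rewrite !sumrB big_split /= sumr_const.
  rewrite !sumrB big_split /= sumr_const sumrMnl !natk.
  rewrite [X in _ - _ - X = _]exchange_big /= /S /T; ring.
(* The terms with [i = j] vanish, which leaves [k * (k - 1)] ordered pairs. *)
have le_D : `|D| <= 2 * k * (k - 1).
  apply: le_trans (ler_norm_sum _ _ _) _.
  have -> : 2 * k * (k - 1) = \sum_(i in K) (2 * (k - 1)).
    by rewrite sumr_const natk; ring.
  apply: ler_sum => i iK; apply: le_trans (ler_norm_sum _ _ _) _.
  rewrite (bigD1 i) //=.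
  have -> : U i i + U i i - U i i - U i i = 0 by ring.
  rewrite normr0 add0r.
  have -> : 2 * (k - 1) = \sum_(j in K | j != i) 2.
    have -> : k - 1 = \sum_(j in K | j != i) 1.
      by rewrite /k -sum1_card natr_sum (bigD1 i) //= addrAC subrr add0r.
    by rewrite mulr_sumr; apply: eq_bigr => j _; rewrite mulr1.
  by apply: ler_sum => j /andP[_ ji]; rewrite D_le // eq_sym.
have -> : \sum_(i in K) \sum_(j in K | i != j) U i j = S - T.
  rewrite -sumrB; apply: eq_bigr => i iK.
  rewrite [in RHS](bigD1 i) //= addrAC subrr add0r.
  by apply: eq_bigl => j; rewrite eq_sym.
(* Each of the two terms has modulus at most [k - 1]; bounding [S] and [T] separately would only
   give [2 * k]. *)
have -> : S - T = (k - 1) / k * S - D / (2 * k).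
  by rewrite eqD; field; rewrite k_neq0.
apply: le_trans (ler_normB _ _) _.
have -> : 2 * k - 2 = (k - 1) / k * k + 2 * k * (k - 1) / (2 * k).
  by field; rewrite k_neq0.
have c_ge0 : 0 <= (k - 1) / k by rewrite divr_ge0 ?subr_ge0 // ltW.
have k2_gt0 : 0 < 2 * k by rewrite mulr_gt0 ?ltr0n.
rewrite (normrM _ S) (normrM D) (ger0_norm c_ge0) normfV (gtr0_norm k2_gt0).
by rewrite lerD ?ler_wpM2l // ler_wpM2r // invr_ge0 ltW.
Qed.

Lemma adjacency_normal (C : numClosedFieldType) (V : finType)
    (H : hypergraph V) : adjacency C H \is normalmx.
Proof.
suff /normalmxP : adjacency C H *m (adjacency C H) ^t* =
  (adjacency C H) ^t* *m adjacency C H by [].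
suff -> : (adjacency C H) ^t* = adjacency C H by [].
apply/matrixP => i j; rewrite !mxE eq_sym; case: eqP => _; first exact: conjC0.
rewrite conjC_nat; congr (_%:R); apply: eq_card => f.
by rewrite !inE [(enum_val j \in f) && _]andbC.
Qed.

Lemma codegree_delete (V : finType) (H : hypergraph V) (e : {set V}) (i j : V) :
  e \in edges H ->
  codegree H i j = (((i \in e) && (j \in e)) + codegree (edge_delete H e) i j)%N.
Proof.
move=> he; rewrite /codegree (cardsD1 e) inE he; congr (_ + _)%N.
by apply: eq_card => f; rewrite !inE andbA.
Qed.

(** Deleting [e] lowers by 1 exactly the off-diagonal entries with both indices in [e], so the trace
    is the sum of the off-diagonal entries of [U] over [e]. *)
Lemma norm_mxtrace_adjacency_delete_le (C : numClosedFieldType) (V : finType)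
    (H : hypergraph V) (e : {set V}) (U : 'M[C]_#|V|) :
  e \in edges H -> U \is unitarymx ->
  `|\tr ((adjacency C H - adjacency C (edge_delete H e)) *m U)|
    <= 2 * #|e|%:R - 2.
Proof.
move=> he Uu; pose K : {set 'I_#|V|} := [set i | enum_val i \in e].
have cardK : #|K| = #|e|.
  rewrite -(card_imset _ (@enum_val_inj V V)); apply: eq_card => x.
  apply/imsetP/idP => [[i]|xe]; first by rewrite inE => ? ->.
  by exists (enum_rank x); rewrite ?inE enum_rankK.
have K_gt0 : (0 < #|K|)%N by rewrite cardK (leq_trans _ (card_edge he)).
rewrite -cardK.
suff -> : \tr ((adjacency C H - adjacency C (edge_delete H e)) *m U) =
    \sum_(i in K) \sum_(j in K | i != j) U i j.
  exact: unitary_offdiag_le.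
rewrite mxtrace_mulC [RHS]big_mkcond; apply: eq_bigr => i _; rewrite mxE.
case: ifPn => iK.
  rewrite [RHS]big_mkcond; apply: eq_bigr => j _.
  rewrite !mxE (eq_sym i) (codegree_delete _ _ _ _ _ he) natrD; move: iK; rewrite !inE => ->.
  by case: eqP => _; rewrite ?andbF ?andbT ?subrr ?mulr0 ?addrK //;
    case: ifP; rewrite ?mulr1 ?mulr0.
rewrite big1 // => j _; rewrite !mxE (codegree_delete _ _ _ _ _ he) natrD.
move: iK; rewrite inE => /negPf ->.
by case: eqP => _; rewrite ?andbF ?addrK ?subrr mulr0.
Qed.

Theorem theorem12 (C : numClosedFieldType) (V : finType) (H : hypergraph V)
    (e : {set V}) (he : e \in edges H) :
  `|energy C H - energy C (edge_delete H e)| <= 2 * #|e|%:R - 2.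
Proof.
have tr_le (U : 'M[C]_#|V|) := norm_mxtrace_adjacency_delete_le C V H e U he.
(* The order on [C] is partial: the energies must be known to be real before the absolute value
   splits into two inequalities. *)
have energy_ge0 H' : 0 <= energy C (V := V) H' by exact: sumr_ge0.
rewrite real_ler_norml ?rpredB ?ger0_real // lerBlDr lerNl opprB lerBlDr.
apply/andP; split.
  (* For each inequality, the phases come from the matrix whose energy is bounded above; the
     triangle inequality then compares it with the other matrix. *)
  have [U Uu trU] := normal_phase _ _ _ (adjacency_normal C _ (edge_delete H e)).
  rewrite -{1}(ger0_norm (energy_ge0 (edge_delete H e))) /energy -trU.
  rewrite -[adjacency C (edge_delete H e)](subKr (adjacency C H)) mulmxBl raddfB /=.
  apply: le_trans (ler_normB _ _) _; rewrite addrC.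
  by rewrite lerD ?tr_le ?norm_mxtrace_normal_le ?adjacency_normal.
have [U Uu trU] := normal_phase _ _ _ (adjacency_normal C _ H).
rewrite -{1}(ger0_norm (energy_ge0 H)) /energy -trU.
rewrite -[adjacency C H](subrK (adjacency C (edge_delete H e))) mulmxDl raddfD /=.
apply: le_trans (ler_normD _ _) _.
by rewrite lerD ?tr_le ?norm_mxtrace_normal_le ?adjacency_normal.
Qed.
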